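(* For positive integers $n_1,\ldots,n_d$ and any $(d-1)$-dimensional partition $\rho$ with $D(\rho)\subseteq[n_2]\times\cdots\times[n_d]\times\mathbb{Z}_+$, the polynomial $g_{\rho}(\mathbf{x}^{(1)};\ldots;\mathbf{x}^{(d)})$ is quasisymmetric in the variables $\mathbf{x}^{(1)}$: for all $k\ge1$, $1\le\ell_1<\cdots<\ell_k\le n_1$, $1\le j_1<\cdots<j_k\le n_1$ and $a_1,\ldots,a_k\in\mathbb{Z}_+$, the coefficient of $(x^{(1)}_{\ell_1})^{a_1}\cdots(x^{(1)}_{\ell_k})^{a_k}$ in $g_\rho$ equals the coefficient of $(x^{(1)}_{j_1})^{a_1}\cdots(x^{(1)}_{j_k})^{a_k}$, where $g_\rho$ is regarded as a polynomial in $\mathbf{x}^{(1)}$ with coefficients in $\mathbb{Z}[\mathbf{x}^{(2)},\ldots,\mathbf{x}^{(d)}]$.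
   Context: A $k$-dimensional partition is an array $\pi=(\pi_{\mathbf{i}})_{\mathbf{i}\in\mathbb{Z}_+^k}$ of nonnegative integers with finitely many nonzero entries, weakly decreasing in each coordinate; $D(\pi)=\{(\mathbf{i},i)\in\mathbb{Z}_+^{k+1}:1\le i\le\pi_{\mathbf{i}}\}$. For a $d$-dimensional partition $\pi$: $\mathrm{Cor}(\pi)=\{\mathbf{i}\in D(\pi):\mathbf{i}+\mathbf{e}_\ell\notin D(\pi)\ \forall\ell\in[d]\}$ ($\mathbf{e}_\ell$ standard basis of $\mathbb{Z}^{d+1}$), $\mathrm{sh}_1(\pi)=\{(i_2,\ldots,i_{d+1}):(i_1,\ldots,i_{d+1})\in D(\pi)\}$. Variables $\mathbf{x}^{(k)}=(x^{(k)}_1,\ldots,x^{(k)}_{n_k})$. $g_\rho(\mathbf{x}^{(1)};\ldots;\mathbf{x}^{(d)})=\sum_{\pi}\prod_{(i_1,\ldots,i_{d+1})\in\mathrm{Cor}(\pi)}x^{(1)}_{i_1}\cdots x^{(d)}_{i_d}$, summed over $d$-dimensional partitions $\pi$ with $D(\pi)\subseteq[n_1]\times\cdots\times[n_d]\times\mathbb{Z}_+$ and $\mathrm{sh}_1(\pi)=D(\rho)$. *)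

(* Defs.v *)
From HB Require Import structures.
From mathcomp Require Import all_boot all_order all_algebra.
From mathcomp Require Import boolp classical_sets functions cardinality fsbigop.
From mathcomp.multinomials Require Import mpoly.

Set Implicit Arguments.
Unset Strict Implicit.
Unset Printing Implicit Defensive.

Import GRing.Theory.
Local Open Scope classical_set_scope.
Local Open Scope ring_scope.

(* All coordinates and all variable indices are shifted down by one: the
   positive integer i is encoded as the natural number i - 1.  So Z_+^m is
   m.-tuple nat, [n] is {i | i < n}, and 1 <= i <= pi_i becomes j < pi i. *)

Definition addE (m : nat) (p : m.-tuple nat) (l : 'I_m) : m.-tuple nat :=
  [tuple (tnth p j + (j == l))%N | j < m].

Definition is_partition (k : nat) (pi : k.-tuple nat -> nat) : Prop :=
  finite_set [set i | pi i <> 0%N] /\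
  (forall (i : k.-tuple nat) (l : 'I_k), (pi (addE i l) <= pi i)%N).

Definition diagram (k : nat) (pi : k.-tuple nat -> nat) :
    set (k.+1.-tuple nat) :=
  [set p | exists (i : k.-tuple nat) (j : nat),
     p = [tuple of rcons i j] /\ (j < pi i)%N].

Definition Cor (d : nat) (pi : d.-tuple nat -> nat) : set (d.+1.-tuple nat) :=
  [set p | diagram pi p /\
     forall l : 'I_d, ~ diagram pi (addE p (widen_ord (leqnSn d) l))].

Definition sh1 (d : nat) (pi : d.+1.-tuple nat -> nat) :
    set (d.+1.-tuple nat) :=
  [set [tuple of behead p] | p in diagram pi].

(* [n_1] x ... x [n_m] x Z_+ *)
Definition box (m : nat) (n : 'I_m -> nat) : set (m.+1.-tuple nat) :=
  [set p | forall l : 'I_m, (tnth p (widen_ord (leqnSn m) l) < n l)%N].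

Definition g_index (d : nat) (n : 'I_d.+1 -> nat) (rho : d.-tuple nat -> nat) :
    set (d.+1.-tuple nat -> nat) :=
  [set pi | [/\ is_partition pi, diagram pi `<=` box n
              & sh1 pi = diagram rho]].

(* g_rho(x^(1); ...; x^(d+1)), where x k i stands for x^(k+1)_(i+1).
   The value of x k i is irrelevant when n k <= i. *)
Definition g (R : comNzRingType) (d : nat) (n : 'I_d.+1 -> nat)
    (rho : d.-tuple nat -> nat) (x : 'I_d.+1 -> nat -> R) : R :=
  \sum_(pi \in g_index n rho)
    \big[*%R/1]_(p \in Cor pi)
      \prod_(k < d.+1) x k (tnth p (widen_ord (leqnSn d.+1) k)).

(* The variables of x^(2), ..., x^(d+1). *)
Definition tail_var (d : nat) (n : 'I_d.+1 -> nat) : finType :=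
  {k : 'I_d & 'I_(n (lift ord0 k))}.

(* Z[x^(2), ..., x^(d+1)] *)
Definition tail_poly (d : nat) (n : 'I_d.+1 -> nat) : comNzRingType :=
  {mpoly int[#|tail_var n|]}.

(* The variables x^(k)_i as elements of Z[x^(2), ..., x^(d+1)][x^(1)], with
   the junk value 0 for indices out of range. *)
Definition xvar (d : nat) (n : 'I_d.+1 -> nat) (k : 'I_d.+1) (i : nat) :
    {mpoly (tail_poly n)[n ord0]} :=
  match unlift ord0 k with
  | None => if (insub i : option 'I_(n ord0)) is Some i' then 'X_i' else 0
  | Some k' =>
    if (insub i : option 'I_(n (lift ord0 k'))) is Some i' then
      let v : tail_var n := existT _ k' i' in
      ('X_(enum_rank v) : tail_poly n)%:MP
    else 0
  end.

Definition g_poly (d : nat) (n : 'I_d.+1 -> nat) (rho : d.-tuple nat -> nat) :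
    {mpoly (tail_poly n)[n ord0]} :=
  g n rho (@xvar d n).

(* The iterated operators in g range over finite sets, so that they are
   genuine sums and products. *)

Lemma finite_diagram (k : nat) (pi : k.-tuple nat -> nat) :
  is_partition pi -> finite_set (diagram pi).
Proof.
move=> [fpi _].
have -> : diagram pi = \bigcup_(i in [set i | pi i <> 0%N])
    ((fun j => [tuple of rcons i j]) @` `I_(pi i)).
  apply/seteqP; split=> p.
    move=> [i [j [-> ji]]]; exists i; last by exists j.
    by move=> pi0; rewrite pi0 in ji.
  by move=> [i _ [j ji <-]]; exists i, j.
by apply: bigcup_finite => // i _; apply: finite_image; exact: finite_II.
Qed.

Lemma finite_Cor (d : nat) (pi : d.-tuple nat -> nat) :
  is_partition pi -> finite_set (Cor pi).
Proof. by move=> /finite_diagram; apply: sub_finite_set => p []. Qed.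

Lemma diagram_inj (k : nat) : injective (@diagram k).
Proof.
move=> pi pi' e; apply/funext => i.
have rI (i' : k.-tuple nat) j j' :
    [tuple of rcons i j] = [tuple of rcons i' j'] -> i = i' /\ j = j'.
  move=> /(congr1 val) /= /eqP; rewrite eqseq_rcons => /andP[/eqP ii /eqP ->].
  by split=> //; apply: val_inj.
have E (f : k.-tuple nat -> nat) j :
    diagram f [tuple of rcons i j] <-> (j < f i)%N.
  split; first by move=> [i' [j' [/rI[<- <-]]]].
  by move=> ji; exists i, j.
apply/eqP; rewrite eqn_leq; apply/andP; split; rewrite leqNgt; apply/negP.
  by move=> /E; rewrite e => /E; rewrite ltnn.
by move=> /E; rewrite -e => /E; rewrite ltnn.
Qed.

Lemma finite_g_index (d : nat) (n : 'I_d.+1 -> nat)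
    (rho : d.-tuple nat -> nat) :
  is_partition rho -> finite_set (g_index n rho).
Proof.
move=> /finite_diagram fr.
have : finite_set [set [tuple of (i : nat) :: q] | i in `I_(n ord0)
                     & q in diagram rho].
  by apply: finite_image2 => //; exact: finite_II.
move=> /finite_seqP[s sE].
pose enc (pi : d.+1.-tuple nat -> nat) : {ffun seq_sub s -> bool} :=
  [ffun p => `[< diagram pi (val p) >]].
have subs pi p : g_index n rho pi -> diagram pi p -> p \in s.
  move=> [_ pib pis] pip; suff : [set` s] p by [].
  rewrite -sE; exists (thead p).
    by have := pib _ pip ord0; rewrite /thead (_ : widen_ord _ _ = ord0) //;
       apply: val_inj.
  exists [tuple of behead p]; first by rewrite -pis; exists p.
  by apply: val_inj; rewrite [in RHS](tuple_eta p).
pose dec f := xget (fun=> 0%N) [set pi | g_index n rho pi /\ enc pi = f].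
apply: (@sub_finite_set _ _ (range dec)); last by apply: finite_image; exact: finite_finset.
move=> pi Ipi; exists (enc pi) => //; rewrite /dec.
case: xgetP => [pi' _ [Ipi' /ffunP e]|/(_ pi)]; last by case.
apply: diagram_inj; apply/seteqP; split=> p Dp.
  have ps := subs _ _ Ipi' Dp.
  by have := e (SeqSub ps); rewrite !ffunE /= (asboolT Dp) => /esym /asboolP.
have ps := subs _ _ Ipi Dp.
by have := e (SeqSub ps); rewrite !ffunE /= (asboolT Dp) => /asboolP.
Qed.

(* Main.v *)
(** Cut the diagram of [pi] into slices according to its first coordinate. They
    form a decreasing chain of order ideals from [diagram rho] down to the empty
    set, and the corners with first coordinate [i] depend only on the slices [i]
    and [i.+1]. There is no such corner exactly when these two slices coincide,
    so the partitions contributing to the monomial with support [l] are the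
    chains whose jumps occur precisely at the times [l s]. Moving each jump from
    [l s] to [j s] is a bijection between the contributions to the two monomials,
    and it changes neither the exponents nor the factor in the other variables. *)

Require Import Defs.
From mathcomp Require Import all_boot all_order all_algebra.
From mathcomp Require Import boolp classical_sets functions cardinality fsbigop.
From mathcomp.multinomials Require Import mpoly.

Set Implicit Arguments.
Unset Strict Implicit.
Unset Printing Implicit Defensive.

Import GRing.Theory.
Local Open Scope classical_set_scope.
Local Open Scope ring_scope.

(** * Strictly increasing jump times and the rank of a time among them *)

Definition increasing_ord (k N : nat) (l : 'I_k -> 'I_N) : Prop :=
  forall s t : 'I_k, (s < t)%N -> (l s < l t)%N.

Section Rank.
Variables (k N : nat) (l : 'I_k -> 'I_N).

(* [l] followed by the constant [N], the level at which every slice is empty. *)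
Definition level (s : nat) : nat :=
  if insub s is Some s' then val (l s') else N.

(** For increasing [l] this counts the [s] with [l s < i], so it is the index of the first jump at
    or after time [i]. When no jump is left, [find] returns [k]. *)
Definition rank (i : nat) : nat := find (fun s => i <= level s)%N (iota 0 k).

Lemma level_ord (s : 'I_k) : level s = l s.
Proof. by rewrite /level valK. Qed.

Lemma level_default : level k = N.
Proof. by rewrite /level insubN // ltnn. Qed.

Lemma rank_le i : (rank i <= k)%N.
Proof. by rewrite -[X in (_ <= X)%N](size_iota 0 k) find_size. Qed.

Hypothesis hl : increasing_ord l.

Lemma level_ltn s t : (s < t)%N -> (t <= k)%N -> (level s < level t)%N.
Proof.
move=> st tk; have sk := leq_trans st tk.
rewrite (level_ord (Ordinal sk)).
move: tk; rewrite leq_eqVlt => /orP[/eqP ->|tk]; first by rewrite level_default.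
by rewrite (level_ord (Ordinal tk)); apply: hl.
Qed.

(* [rank] is left adjoint to [level]. *)
Lemma ltn_rank s i : (s < k)%N -> (s < rank i)%N = (level s < i)%N.
Proof.
move=> sk; apply/idP/idP => [sr|].
  by have := before_find 0%N sr; rewrite nth_iota // add0n ltnNge => ->.
apply: contraLR; rewrite -!leqNgt => rs.
have rk := leq_ltn_trans rs sk.
have hr : (i <= level (rank i))%N.
  have := @nth_find _ 0%N (fun s => i <= level s)%N (iota 0 k).
  by rewrite has_find size_iota -/(rank i) nth_iota //; apply.
apply: leq_trans hr _; move: rs; rewrite leq_eqVlt => /orP[/eqP -> //|rs].
by apply/ltnW/level_ltn => //; exact: ltnW.
Qed.

Lemma rank_eq i i' :
  (forall s : 'I_k, (l s < i)%N = (l s < i')%N) -> rank i = rank i'.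
Proof.
move=> h; apply: eq_in_find => s; rewrite mem_iota /= add0n => sk.
by rewrite (level_ord (Ordinal sk)) leqNgt h -leqNgt.
Qed.

Lemma rank_mono i i' : (i <= i')%N -> (rank i <= rank i')%N.
Proof.
move=> ii'; rewrite leqNgt; apply/negP => h.
have sk := leq_trans h (rank_le i).
by move: h; rewrite ltn_rank // => /leq_trans/(_ ii'); rewrite -ltn_rank // ltnn.
Qed.

Lemma rank_level s : (s <= k)%N -> rank (level s) = s.
Proof.
move=> sk; apply/eqP; rewrite eqn_leq; apply/andP; split.
  move: sk; rewrite leq_eqVlt => /orP[/eqP ->|sk]; first exact: rank_le.
  by rewrite leqNgt ltn_rank // ltnn.
rewrite leqNgt; apply/negP => h; have rk := leq_trans h sk.
by have := level_ltn h sk; rewrite -ltn_rank // ltnn.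
Qed.

(** Just after time [l s] the jump [s] has been passed. With [rank_level] this locates both slices
    that decide the corners with head [l s]. *)
Lemma rankS_level (s : 'I_k) : rank (l s).+1 = s.+1.
Proof.
apply/eqP; rewrite eqn_leq; apply/andP; split; last first.
  by rewrite ltn_rank // level_ord.
rewrite leqNgt; apply/negP => h; have sk := leq_trans h (rank_le _).
move: h; rewrite ltn_rank // ltnS -(level_ord s) leqNgt.
by rewrite level_ltn // ltnW.
Qed.

Lemma rank_ge i : (N <= i)%N -> rank i = k.
Proof.
move=> Ni; apply/eqP; rewrite eqn_leq rank_le leqNgt; apply/negP => rk.
have := ltn_rank i rk; rewrite ltnn (level_ord (Ordinal rk)).
by rewrite (leq_trans (ltn_ord _) Ni).
Qed.

(** The unit of the adjunction: [level (rank i)] is the next jump time, counting time [i] itself, or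
    [N] after the last jump. *)
Lemma leq_level_rank i : (i <= N)%N -> (i <= level (rank i))%N.
Proof.
move=> iN; have := rank_le i; rewrite leq_eqVlt => /orP[/eqP ->|rk].
  by rewrite level_default.
by rewrite leqNgt -ltn_rank // ltnn.
Qed.

Lemma rankS_notin i : (forall s, l s <> i :> nat) -> rank i.+1 = rank i.
Proof.
move=> h; apply: rank_eq => s; rewrite ltnS leq_eqVlt.
by case: eqP => // /h.
Qed.

End Rank.

(** * Slices of a partition along its first coordinate, and their corners *)

Section Slices.
Variable d : nat.
Implicit Types (pi : d.+1.-tuple nat -> nat) (t : d.-tuple nat)
  (q : d.+1.-tuple nat).

Definition slice pi (i : nat) : d.-tuple nat -> nat :=
  fun t => pi [tuple of i :: t].

Lemma diagram_rcons (m : nat) (f : m.-tuple nat -> nat) (i : m.-tuple nat)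
    (j : nat) : diagram f [tuple of rcons i j] <-> (j < f i)%N.
Proof.
split; last by move=> ji; exists i, j.
move=> [i' [j' [/(congr1 val) /= /eqP]]].
by rewrite eqseq_rcons => /andP[/eqP/val_inj -> /eqP ->].
Qed.

Lemma rcons_tuple_eta (m : nat) (q : m.+1.-tuple nat) :
  exists (t : m.-tuple nat) (h : nat), q = [tuple of rcons t h].
Proof.
exists [tuple of belast (thead q) (behead q)], (last (thead q) (behead q)).
by apply: val_inj => /=; rewrite -lastI [in LHS](tuple_eta q).
Qed.

Lemma diagram_cons pi i q :
  diagram pi [tuple of i :: q] <-> diagram (slice pi i) q.
Proof.
have [t [h ->]] := rcons_tuple_eta q.
rewrite diagram_rcons -(diagram_rcons pi [tuple of i :: t] h).
by rewrite (_ : [tuple of i :: _] = [tuple of rcons [tuple of i :: t] h]) //;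
   apply: val_inj.
Qed.

Lemma addE_cons0 (m : nat) (i : nat) (t : m.-tuple nat) :
  addE [tuple of i :: t] ord0 = [tuple of i.+1 :: t].
Proof.
apply: eq_from_tnth => a; rewrite tnth_mktuple.
case: (unliftP ord0 a) => [a' ->|->]; first by rewrite !tnthS addn0.
by rewrite !tnth0 addn1.
Qed.

Lemma addE_consS (m : nat) (i : nat) (t : m.-tuple nat) (b : 'I_m) :
  addE [tuple of i :: t] (lift ord0 b) = [tuple of i :: addE t b].
Proof.
apply: eq_from_tnth => a; rewrite tnth_mktuple.
case: (unliftP ord0 a) => [a' ->|->].
  by rewrite !tnthS tnth_mktuple (inj_eq lift_inj).
by rewrite !tnth0 addn0.
Qed.

Lemma addE_rcons (m : nat) (t : m.-tuple nat) (h : nat) (b : 'I_m) :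
  addE [tuple of rcons t h] (widen_ord (leqnSn m) b)
  = [tuple of rcons (addE t b) h].
Proof.
apply: eq_from_tnth => a; rewrite tnth_mktuple !(tnth_nth 0%N) /= !nth_rcons.
rewrite !size_tuple card_ord -!val_eqE /=.
case: ltngtP => [am|am|->]; last first.
- by rewrite gtn_eqF ?addn0 // ltnn eqxx.
- by have := ltn_ord a; rewrite ltnS leqNgt am.
rewrite -[in RHS](tnth_nth 0%N (addE t b) (Ordinal am)) tnth_mktuple.
by rewrite (tnth_nth 0%N) -val_eqE.
Qed.

Lemma diagram_addE (m : nat) (f : m.-tuple nat -> nat) (b : 'I_m)
    (p : m.+1.-tuple nat) : is_partition f ->
  diagram f (addE p (widen_ord (leqnSn m) b)) -> diagram f p.
Proof.
move=> [_ fm]; have [t [h ->]] := rcons_tuple_eta p.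
by rewrite addE_rcons !diagram_rcons => /leq_trans; apply.
Qed.

(** A step in direction [ord0] leads into slice [i.+1], while the directions [lift ord0 b] stay
    inside slice [i]. *)
Lemma Cor_cons pi i q : Cor pi [tuple of i :: q] <->
  [/\ diagram (slice pi i) q, ~ diagram (slice pi i.+1) q &
      forall b : 'I_d, ~ diagram (slice pi i) (addE q (widen_ord (leqnSn d) b))].
Proof.
have w0 : widen_ord (leqnSn d.+1) ord0 = ord0 by apply: val_inj.
have wS (b : 'I_d) : widen_ord (leqnSn d.+1) (lift ord0 b)
                     = lift ord0 (widen_ord (leqnSn d) b) by apply: val_inj.
split.
  move=> [/diagram_cons Dq h]; split=> //.
    by rewrite -diagram_cons -addE_cons0 -w0; exact: h.
  by move=> b; rewrite -diagram_cons -addE_consS -wS; exact: h.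
move=> [Dq D0 Db]; split; first exact/diagram_cons.
move=> b; case: (unliftP ord0 b) => [b' ->|->].
  by rewrite wS addE_consS diagram_cons.
by rewrite w0 addE_cons0 diagram_cons.
Qed.

Lemma slice_partition pi i : is_partition pi -> is_partition (slice pi i).
Proof.
move=> [fpi mpi]; split; last by move=> t b; rewrite /slice -addE_consS.
apply: (@sub_finite_set _ _ ((fun p => [tuple of behead p]) @`
          [set p | pi p <> 0%N])); last exact: finite_image.
by move=> t ht; exists [tuple of i :: t] => //; apply: val_inj.
Qed.

Lemma slice_anti pi i i' t : is_partition pi -> (i <= i')%N ->
  (slice pi i' t <= slice pi i t)%N.
Proof.
move=> [_ mpi] /subnK <-; elim: (i' - i)%N => // m; apply: leq_trans.
by rewrite addSn /slice -addE_cons0.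
Qed.

Lemma sumn_addE (m : nat) (p : m.-tuple nat) b : sumn (addE p b) = (sumn p).+1.
Proof.
rewrite !sumnE !big_tuple; under eq_bigr do rewrite tnth_mktuple.
rewrite big_split /= -addn1; congr (_ + _)%N.
rewrite (bigD1 b) //= eqxx big1 // => i /negbTE.
by case: eqVneq.
Qed.

(* From a point of slice [i] outside slice [i.+1], moving up as far as possible
   inside slice [i] never enters slice [i.+1], so it ends in a corner. *)
Lemma slice_eq_noCor pi i : is_partition pi ->
  (forall q, ~ Cor pi [tuple of i :: q]) -> slice pi i.+1 = slice pi i.
Proof.
move=> ppi nC.
have ps := slice_partition i ppi; have ps' := slice_partition i.+1 ppi.
have [s sE] : exists s : seq (d.+1.-tuple nat), diagram (slice pi i) = [set` s].
  by apply/finite_seqP; exact: finite_diagram.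
(* A unit step raises the coordinate sum by one and the finite diagram bounds that sum, so the gap
   to the maximum is the induction measure. *)
have bd q : diagram (slice pi i) q -> (sumn q <= \max_(x <- s) sumn x)%N.
  by rewrite sE => qs; rewrite (big_rem q) //= leq_maxl.
have main m : forall q, (\max_(x <- s) sumn x - sumn q < m)%N ->
    diagram (slice pi i) q -> diagram (slice pi i.+1) q.
  elim: m => // m IH q hm Dq; apply: contrapT => nD; apply: (nC q).
  apply/Cor_cons; split=> // b Db; apply: nD.
  apply: (diagram_addE ps'); apply: (IH _ _ Db).
  have := bd _ Db; rewrite sumn_addE => lt.
  by rewrite -ltnS; apply: leq_trans hm; rewrite ltnS ltn_sub2l.
apply: diagram_inj; apply/seteqP; split=> q; last exact: (main _ _ (leqnn _)).
have [t [h ->]] := rcons_tuple_eta q; rewrite !diagram_rcons => /leq_trans; apply.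
exact: slice_anti.
Qed.

End Slices.

(** * Moving the jump times of a chain of slices *)

Definition map_head (m : nat) (phi : nat -> nat) (p : m.+1.-tuple nat) :
    m.+1.-tuple nat :=
  [tuple of phi (thead p) :: [tuple of behead p]].

Lemma map_head_cons (m : nat) (phi : nat -> nat) (i : nat) (q : m.-tuple nat) :
  map_head phi [tuple of i :: q] = [tuple of phi i :: q].
Proof. by apply: val_inj. Qed.

(* [relabel l j] maps [l s] to [j s], and [N] to [N]. *)
Definition relabel (k N : nat) (l j : 'I_k -> 'I_N) (i : nat) : nat :=
  level j (rank l i).

Lemma relabel_ord (k N : nat) (l j : 'I_k -> 'I_N) (s : 'I_k) :
  increasing_ord l -> relabel l j (l s) = j s.
Proof. by move=> hl; rewrite /relabel -level_ord rank_level ?level_ord // ltnW. Qed.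

Section Retime.
Variables (d k : nat) (n : 'I_d.+1 -> nat) (rho : d.-tuple nat -> nat).
Implicit Types (pi : d.+1.-tuple nat -> nat) (l j : 'I_k -> 'I_(n ord0)).

(** Precomposition reverses direction: to move jumps from [l] to [j], time [i] of the new chain
    reads [pi] at the time [relabel j l i]. *)
Definition retime l j pi : d.+1.-tuple nat -> nat :=
  fun p => pi (map_head (relabel j l) p).

Lemma slice_retime l j pi i :
  slice (retime l j pi) i = slice pi (relabel j l i).
Proof. by apply/funext => t; rewrite /slice /retime map_head_cons. Qed.

(** By [slice_eq_noCor], the slices of such a partition can change only right after a time [l s]. A
    given [l s] may carry no corner. *)
Definition Cor_heads_in l pi : Prop :=
  forall i (q : d.+1.-tuple nat), Cor pi [tuple of i :: q] -> exists s, l s = i :> nat.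

(** No jump time lies in the interval from [i] up to, but excluding, the next one, so the chain is
    constant there. *)
Lemma slice_next l pi i : increasing_ord l -> is_partition pi ->
  Cor_heads_in l pi -> (i <= n ord0)%N ->
  slice pi (level l (rank l i)) = slice pi i.
Proof.
move=> hl ppi hc iN; have := leq_level_rank hl iN => /subnK <-.
have := leqnn (level l (rank l i) - i).
(* The gap is generalised to every [m] not exceeding it, with claim
   [slice pi (m + i) = slice pi i]. *)
elim: {1 3}(_ - i)%N => // m IH hm.
rewrite addSn slice_eq_noCor //; first by apply: IH; exact: ltnW.
move=> q /hc [s ls].
(* A corner with head [m + i] would give a jump [l s] before the next jump time after [i]; then
   [s < rank l i], which forces [l s < i]. *)
have lt : (l s < level l (rank l i))%N by rewrite ls addnC -ltn_subRL.
have sr : (s < rank l i)%N.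
  rewrite ltnNge; apply/negP; rewrite leq_eqVlt => /orP[/eqP e|lt'].
    by move: lt; rewrite e level_ord ltnn.
  have := level_ltn hl lt' (ltnW (ltn_ord s)).
  by rewrite level_ord => /(ltn_trans lt); rewrite ltnn.
by move: sr; rewrite ltn_rank // level_ord ls ltnNge leq_addl.
Qed.

Lemma slice_ge pi i : diagram pi `<=` box n -> (n ord0 <= i)%N ->
  slice pi i = fun=> 0%N.
Proof.
move=> hb iN; apply/funext => t; apply/eqP; rewrite -leqn0 leqNgt; apply/negP.
move=> /diagram_rcons/diagram_cons/hb/(_ ord0).
rewrite (_ : widen_ord _ _ = ord0); last exact: val_inj.
by rewrite tnth0 ltnNge iN.
Qed.

Lemma relabel_ge l j i : increasing_ord l -> (n ord0 <= i)%N ->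
  relabel l j i = n ord0.
Proof. by move=> hl iN; rewrite /relabel rank_ge // level_default. Qed.

(** The round trip sends a time [i] up to [n ord0] to the next jump time [level l (rank l i)], in
    general not to [i], but [slice_next] identifies the two slices. Later slices are empty. *)
Lemma retimeK l j pi : increasing_ord l -> increasing_ord j ->
  is_partition pi -> diagram pi `<=` box n -> Cor_heads_in l pi ->
  retime j l (retime l j pi) = pi.
Proof.
move=> hl hj ppi hb hc; apply/funext => p; case/tupleP: p => i t.
suff : slice (retime j l (retime l j pi)) i = slice pi i by move/(congr1 (@^~ t)).
rewrite !slice_retime; have [iN|/ltnW Ni] := leqP i (n ord0).
  by rewrite {1}/relabel rank_level ?rank_le // slice_next.
by rewrite !relabel_ge // !slice_ge.
Qed.

(** Around [j s] the new chain shows the same two consecutive slices as [pi] around [l s], so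
    [Cor_cons] matches their corners. *)
Lemma map_head_Cor l j pi : increasing_ord l -> increasing_ord j ->
  is_partition pi -> Cor_heads_in l pi ->
  set_bij (Cor pi) (Cor (retime l j pi)) (map_head (relabel l j)).
Proof.
move=> hl hj ppi hc.
have sl (s : 'I_k) : slice pi (relabel j l (j s)) = slice pi (l s).
  by rewrite relabel_ord.
(* Time [(j s).+1] is read at [level l s.+1], the next jump time counted from [(l s).+1], where
   [slice_next] applies. *)
have slS (s : 'I_k) : slice pi (relabel j l (j s).+1) = slice pi (l s).+1.
  rewrite /relabel rankS_level // -(slice_next hl ppi hc (ltn_ord (l s))).
  by rewrite rankS_level.
have CE (s : 'I_k) (q : d.+1.-tuple nat) :
    Cor (retime l j pi) [tuple of nat_of_ord (j s) :: q] <->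
    Cor pi [tuple of nat_of_ord (l s) :: q].
  by rewrite !Cor_cons !slice_retime sl slS.
split.
- move=> p; case/tupleP: p => i q Ci; have [s ls] := hc _ _ Ci.
  by rewrite map_head_cons -ls relabel_ord //; apply/CE; rewrite ls.
- move=> p p' /set_mem + /set_mem; case/tupleP: p => i q; case/tupleP: p' => i' q'.
  move=> /[dup]/hc[s <-] _ /[dup]/hc[s' <-] _; rewrite !map_head_cons !relabel_ord //.
  move=> /(congr1 (map_head (relabel j l))).
  by rewrite !map_head_cons !relabel_ord.
- move=> p; case/tupleP: p => i q Ci.
  (* Away from the times [j s] the rank does not change from [i] to [i.+1]; the two slices then
     coincide and exclude a corner. *)
  have [[s js]|no] := pselect (exists s, j s = i :> nat); last first.
    move: Ci => /Cor_cons[]; rewrite !slice_retime /relabel rankS_notin //.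
    by move=> s js; apply: no; exists s.
  exists [tuple of nat_of_ord (l s) :: q]; first by apply/CE; rewrite js.
  by rewrite map_head_cons relabel_ord // js.
Qed.

(** Relabelling is monotone, which keeps the chain decreasing, and it fixes [n ord0], which keeps
    the box. The shape is slice [0], and no jump occurs before the first jump time. *)
Lemma g_index_retime l j pi : increasing_ord l -> increasing_ord j ->
  g_index n rho pi -> Cor_heads_in l pi -> g_index n rho (retime l j pi).
Proof.
move=> hl hj [ppi hb hs] hc; have [fpi mpi] := ppi.
have lt i (t : d.-tuple nat) : retime l j pi [tuple of i :: t] <> 0%N -> (i < n ord0)%N.
  move=> h; rewrite ltnNge; apply/negP => Ni; apply: h.
  rewrite -/(slice (retime l j pi) i t) slice_retime relabel_ge //.
  by rewrite slice_ge.
split.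
- split.
    apply: (@sub_finite_set _ _ [set [tuple of (i : nat) :: [tuple of behead p]] |
      i in `I_(n ord0) & p in [set p | pi p <> 0%N]]); last first.
      by apply: finite_image2 => //; exact: finite_II.
    move=> p; case/tupleP: p => i t /= h; exists i; first exact: lt h.
    by exists (map_head (relabel j l) [tuple of i :: t]) => //; apply: val_inj.
  move=> p b; case/tupleP: p => i t.
  case: (unliftP ord0 b) => [b' ->|->].
    rewrite addE_consS -!/(slice (retime l j pi) _ _) slice_retime.
    by rewrite /slice -addE_consS.
  rewrite addE_cons0 -!/(slice (retime l j pi) _ _) !slice_retime.
  apply: slice_anti => //; rewrite /relabel.
  have := rank_mono hj (leqnSn i); rewrite leq_eqVlt => /orP[/eqP -> //|h].
  by apply/ltnW/level_ltn => //; exact: rank_le.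
- move=> p; case/tupleP: p => i q Dq a.
  case: (unliftP ord0 a) => [a' ->|->].
    move: Dq; rewrite diagram_cons slice_retime -diagram_cons => /hb/(_ (lift ord0 a')).
    rewrite (_ : widen_ord _ _ = lift ord0 (widen_ord (leqnSn d) a')).
      by rewrite !tnthS.
    exact: val_inj.
  rewrite (_ : widen_ord _ _ = ord0); last exact: val_inj.
  rewrite tnth0; move: Dq; have [t [h ->]] := rcons_tuple_eta q.
  rewrite diagram_cons diagram_rcons => hp; apply: (@lt i t).
  by move=> e; move: hp; rewrite /slice e.
- rewrite -hs; apply/seteqP; split=> q' [p]; case/tupleP: p => i q.
    rewrite diagram_cons slice_retime -diagram_cons => Dq <-.
    by exists [tuple of relabel j l i :: q] => //; apply: val_inj.
  move=> /diagram_cons Dq <-; exists [tuple of 0%N :: q]; last exact: val_inj.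
  rewrite diagram_cons slice_retime.
  (* Both ranks of time [0] are [0]: the test [0 <= level s] succeeds at once, and for [k = 0] the
     list is empty. *)
  have -> : relabel j l 0 = level l (rank l 0).
    by congr (level l _); rewrite /rank; case: (k).
  rewrite slice_next //; move: Dq; have [t [h ->]] := rcons_tuple_eta q.
  by rewrite !diagram_rcons => /leq_trans; apply; exact: slice_anti.
Qed.

End Retime.

(** * Exponents in the first variables and coefficients in the remaining ones *)

Section Weight.
Variables (d : nat) (n : 'I_d.+1 -> nat).
Implicit Types (pi : d.+1.-tuple nat -> nat).

Definition head_mon (N i : nat) : 'X_{1..N} :=
  if (insub i : option 'I_N) is Some i' then U_(i')%MM else 0%MM.

Definition Cor_mon pi : 'X_{1..n ord0} :=
  \big[mnm_add/0%MM]_(p \in Cor pi) head_mon (n ord0) (thead p).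

(** The value [0] out of range mirrors [xvar], so that [xvar_prod] holds for every tail [q]. *)
Definition tail_weight (q : d.+1.-tuple nat) : tail_poly n :=
  \prod_(a < d)
    if (insub (tnth q (widen_ord (leqnSn d) a)) : option 'I_(n (lift ord0 a)))
      is Some i then 'X_(enum_rank (existT _ a i : tail_var n)) else 0.

Definition Cor_coef pi : tail_poly n :=
  \big[*%R/1]_(p \in Cor pi) tail_weight [tuple of behead p].

Lemma head_mon_ord (N : nat) (i : 'I_N) : head_mon N i = U_(i)%MM.
Proof. by rewrite /head_mon valK. Qed.

Lemma Cor_box pi i (q : d.+1.-tuple nat) : diagram pi `<=` box n ->
  Cor pi [tuple of i :: q] -> (i < n ord0)%N.
Proof.
move=> hb [/hb/(_ ord0)].
by rewrite (_ : widen_ord _ _ = ord0) ?tnth0 //; apply: val_inj.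
Qed.

Lemma xvar_prod (i : nat) (q : d.+1.-tuple nat) : (i < n ord0)%N ->
  \prod_(a < d.+1) @xvar d n a
     (tnth [tuple of i :: q] (widen_ord (leqnSn d.+1) a))
  = (tail_weight q)%:MP * 'X_[head_mon (n ord0) i].
Proof.
move=> iN; rewrite big_ord_recl mulrC; congr (_ * _).
  rewrite /tail_weight rmorph_prod; apply: eq_bigr => a _.
  rewrite /xvar liftK (_ : widen_ord _ _ = lift ord0 (widen_ord (leqnSn d) a));
    last exact: val_inj.
  by rewrite tnthS; case: insubP => //= _; rewrite raddf0.
rewrite /xvar unlift_none (_ : widen_ord _ _ = ord0); last exact: val_inj.
by rewrite tnth0 /head_mon insubT.
Qed.

Lemma Cor_prodE pi : is_partition pi -> diagram pi `<=` box n ->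
  \big[*%R/1]_(p \in Cor pi)
    \prod_(a < d.+1) @xvar d n a (tnth p (widen_ord (leqnSn d.+1) a))
  = (Cor_coef pi)%:MP * 'X_[Cor_mon pi].
Proof.
move=> /finite_Cor fC hb; rewrite /Cor_coef /Cor_mon !fsbig_finite //.
rewrite -mprodXE rmorph_prod -big_split /=; apply: eq_big_seq => p.
rewrite in_fset_set // => /set_mem; case/tupleP: p => i q Ci.
rewrite xvar_prod; last exact: Cor_box Ci.
by congr ((tail_weight _)%:MP * 'X_[_]); apply: val_inj.
Qed.

(** By [Cor_prodE] each partition contributes a single monomial in the first variables, so
    extracting a coefficient selects partitions. *)
Lemma mcoeff_g_poly rho (m : 'X_{1..n ord0}) : is_partition rho ->
  (g_poly n rho)@_m
  = \sum_(pi \in g_index n rho `&` [set pi | Cor_mon pi = m]) Cor_coef pi.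
Proof.
move=> hrho; have fg := finite_g_index n hrho.
rewrite fsbig_mkcondr /g_poly /g !fsbig_finite // raddf_sum /=.
apply: eq_big_seq => pi; rewrite in_fset_set // => /set_mem[ppi hb _].
rewrite Cor_prodE // mcoeffCM mcoeffX.
case: ifPn => [/set_mem /= ->|/negP]; first by rewrite eqxx mulr1.
case: eqP => [e []|]; first exact/mem_set.
by rewrite mulr0.
Qed.

Variables (k : nat) (a : 'I_k -> nat).
Implicit Types (l j : 'I_k -> 'I_(n ord0)).

(** Exponents are natural numbers and cannot cancel: a corner with head [i] makes the exponent of
    variable [i] positive, so [i] is some [l s]. *)
Lemma Cor_mon_heads l pi : is_partition pi -> diagram pi `<=` box n ->
  Cor_mon pi = (\sum_(s < k) U_(l s) *+ a s)%MM -> Cor_heads_in l pi.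
Proof.
move=> /finite_Cor fC hb e i q Ci; have iN := Cor_box hb Ci.
apply: contrapT => no; have := congr1 (fun m : 'X_{1..n ord0} => m (Ordinal iN)) e.
rewrite [in RHS]mnm_sumE [in RHS]big1; last first.
  move=> s _; rewrite mulmnE mnm1E; case: eqP => // ls.
  by case: no; exists s; rewrite ls.
rewrite /Cor_mon fsbig_finite // mnm_sumE (big_rem [tuple of i :: q]) /=; last first.
  by rewrite in_fset_set //; exact/mem_set.
by rewrite theadE -[i]/(val (Ordinal iN)) head_mon_ord mnm1E eqxx.
Qed.

(** Renaming of variables on exponents. Variables past the last [l s] go to [n ord0], where
    [head_mon] vanishes, and are thus erased. *)
Definition mnm_relabel l j (m : 'X_{1..n ord0}) : 'X_{1..n ord0} :=
  (\sum_(i < n ord0) head_mon (n ord0) (relabel l j i) *+ m i)%MM.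

Lemma mnm_relabelD l j : {morph mnm_relabel l j : m m' / (m + m')%MM}.
Proof.
move=> m m'; apply/mnmP => i; rewrite mnmDE !mnm_sumE -big_split /=.
by apply: eq_bigr => b _; rewrite !mulmnE mnmDE mulnDr.
Qed.

Lemma mnm_relabel0 l j : mnm_relabel l j 0%MM = 0%MM.
Proof. by apply: big1 => i _; rewrite mnm0E mulm0n. Qed.

Lemma mnm_relabelU l j i :
  mnm_relabel l j U_(i)%MM = head_mon (n ord0) (relabel l j i).
Proof.
rewrite /mnm_relabel (bigD1 i) //= mnm1E eqxx mulm1n big1 ?addm0 // => b.
by rewrite mnm1E eq_sym => /negbTE ->; rewrite mulm0n.
Qed.

Lemma mnm_relabel_sum l j : increasing_ord l ->
  mnm_relabel l j (\sum_(s < k) U_(l s) *+ a s)%MM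
  = (\sum_(s < k) U_(j s) *+ a s)%MM.
Proof.
move=> hl; rewrite (big_morph _ (mnm_relabelD l j) (mnm_relabel0 l j)).
apply: eq_bigr => s _; elim: (a s) => [|b IH].
  by rewrite !mulm0n mnm_relabel0.
by rewrite !mulmS mnm_relabelD IH mnm_relabelU relabel_ord // head_mon_ord.
Qed.

Lemma Cor_mon_retime l j pi : increasing_ord l -> increasing_ord j ->
  is_partition pi -> diagram pi `<=` box n -> Cor_heads_in l pi ->
  Cor_mon (retime l j pi) = mnm_relabel l j (Cor_mon pi).
Proof.
move=> hl hj ppi hb hc; have fC := finite_Cor ppi.
rewrite /Cor_mon (reindex_fsbig _ _ _ _ (map_head_Cor hl hj ppi hc)).
rewrite !fsbig_finite // (big_morph _ (mnm_relabelD l j) (mnm_relabel0 l j)).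
apply: eq_big_seq => p; rewrite in_fset_set // => /set_mem.
case/tupleP: p => i q Ci; have iN := Cor_box hb Ci.
rewrite map_head_cons !theadE -[head_mon _ i]/(head_mon _ (Ordinal iN)).
by rewrite head_mon_ord mnm_relabelU.
Qed.

(** The bijection of corners changes heads only, and the weights depend on tails only. *)
Lemma Cor_coef_retime l j pi : increasing_ord l -> increasing_ord j ->
  is_partition pi -> Cor_heads_in l pi ->
  Cor_coef (retime l j pi) = Cor_coef pi.
Proof.
move=> hl hj ppi hc.
rewrite /Cor_coef (reindex_fsbig _ _ _ _ (map_head_Cor hl hj ppi hc)).
by apply: eq_fsbigr => p _; congr tail_weight; apply: val_inj.
Qed.

Lemma retime_g_index rho l j : increasing_ord l -> increasing_ord j ->
  set_fun
    (g_index n rho `&` [set pi | Cor_mon pi = (\sum_(s < k) U_(l s) *+ a s)%MM])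
    (g_index n rho `&` [set pi | Cor_mon pi = (\sum_(s < k) U_(j s) *+ a s)%MM])
    (retime l j).
Proof.
move=> hl hj pi [Ipi /= e]; have [ppi hb _] := Ipi.
have hc := Cor_mon_heads ppi hb e.
split; first exact: g_index_retime.
by rewrite /= Cor_mon_retime // e mnm_relabel_sum.
Qed.

End Weight.

Theorem theorem6p9 (d : nat) (n : 'I_d.+1 -> nat)
    (hn : forall k : 'I_d.+1, (0 < n k)%N)
    (rho : d.-tuple nat -> nat) (hrho : is_partition rho)
    (hbox : diagram rho `<=` box (fun k : 'I_d => n (lift ord0 k)))
    (k : nat) (hk : (1 <= k)%N)
    (l : 'I_k -> 'I_(n ord0))
    (hl : forall s t : 'I_k, (s < t)%N -> (l s < l t)%N)
    (j : 'I_k -> 'I_(n ord0))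
    (hj : forall s t : 'I_k, (s < t)%N -> (j s < j t)%N)
    (a : 'I_k -> nat) (ha : forall s : 'I_k, (0 < a s)%N) :
  (g_poly n rho)@_(\sum_(s < k) U_(l s) *+ a s)%MM
  = (g_poly n rho)@_(\sum_(s < k) U_(j s) *+ a s)%MM.
Proof.
pose I (l : 'I_k -> 'I_(n ord0)) := g_index n rho `&`
  [set pi | Cor_mon n pi = (\sum_(s < k) U_(l s) *+ a s)%MM].
have IP l' pi : I l' pi ->
    [/\ is_partition pi, diagram pi `<=` box n & Cor_heads_in l' pi].
  by move=> [[ppi hb _] e]; split=> //; exact: Cor_mon_heads e.
have bij : set_bij (I l) (I j) (retime l j).
  split; first exact: retime_g_index.
    move=> pi pi' /set_mem/IP[p b c] /set_mem/IP[p' b' c'] e.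
    by rewrite -(retimeK hl hj p b c) e retimeK.
  move=> pi Ipi; have [p b c] := IP _ _ Ipi.
  (* Surjectivity comes from the reverse retiming, with [l] and [j] exchanged in [retimeK]. *)
  exists (retime j l pi); first exact: retime_g_index Ipi.
  exact: retimeK.
(* The sum for [j] is pulled back along the bijection to the index set for [l] and compared term by
   term. *)
rewrite !mcoeff_g_poly // (reindex_fsbig _ _ _ _ bij); apply: eq_fsbigr => pi /set_mem.
by move=> /IP[p _ c]; rewrite Cor_coef_retime.
Qed.
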